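(* Let $c_1,\ldots,c_n$ be positive integers, $n\ge3$. Consider unknowns $x_{i,j}\in\mathbb{R}$, $i,j\in\{1,\ldots,n\}$, subject to the Ptolemy–Plücker relations $$x_{i,j}x_{k,\ell}=x_{i,k}x_{j,\ell}+x_{i,\ell}x_{k,j}\quad(i\le k\le j\le \ell),\qquad x_{i,i}=0,\qquad x_{i,i+1}=1,$$ together with the skew-symmetry condition $x_{i,j}=-x_{j,i}$ and the conditions $x_{i-1,i+1}=c_i$ for all $i$ (indices taken cyclically modulo $n$ in $\{1,\dots,n\}$). This system has a unique solution if and only if $M(c_1,\ldots,c_n)=\mathrm{Id}$.
   Context: $M(c_1,\ldots,c_n)=\prod_{i=1}^{n}\begin{pmatrix}c_i&-1\\1&0\end{pmatrix}$ (product from left to right in increasing index). The indices are thought of as the cyclically ordered vertices of a convex $n$-gon. *)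

(* Defs.v *)
From HB Require Import structures.
From mathcomp Require Import all_boot all_order all_algebra.
From mathcomp Require Import reals.

Set Implicit Arguments.
Unset Strict Implicit.
Unset Printing Implicit Defensive.

Import Order.TTheory GRing.Theory Num.Theory.
Local Open Scope ring_scope.

Definition elem_mx (a : int) : 'M[int]_2 :=
  \matrix_(r < 2, s < 2)
    nth 0 (nth [::] [:: [:: a; -1]; [:: 1; 0]] r) s.

Definition M (n : nat) (c : 'I_n -> int) : 'M[int]_2 :=
  \prod_(i < n) elem_mx (c i).

(* The vertices 1, ..., n are represented by 0, ..., n-1 in 'I_n; [ordS] and
   [ord_pred] are the cyclic successor and predecessor, so that sol_edge
   includes x_{n,1} = 1 and sol_diag includes x_{n,2} = c_1 and
   x_{n-1,1} = c_n.  The chain of inequalities in sol_ptolemy is the linear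
   order of the indices. *)
Record is_solution (R : realType) (n : nat) (c : 'I_n -> int) (x : 'M[R]_n)
    : Prop := IsSolution {
  sol_ptolemy : forall i k j l : 'I_n, (i <= k)%N -> (k <= j)%N -> (j <= l)%N ->
    x i j * x k l = x i k * x j l + x i l * x k j;
  sol_refl : forall i : 'I_n, x i i = 0;
  sol_edge : forall i : 'I_n, x i (ordS i) = 1;
  sol_skew : forall i j : 'I_n, x i j = - x j i;
  sol_diag : forall i : 'I_n, x (ord_pred i) (ordS i) = (c i)%:~R
}.

(* Main.v *)
(* A solution is a system of brackets x_{i,j} = det(v_i, v_j) of vectors of the
   plane.  The Ptolemy relation on i-1, i, i+1, j is the linear recurrence
   x_{i-1,j} = c_i x_{i,j} - x_{i+1,j}, so the pairs (x_{i-1,j}, x_{i,j}) are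
   transported by the partial products E(c_i) ... E(c_n).  Going once around the
   polygon, M fixes two independent vectors, hence M = Id, and x is forced to be
   the matrix of minors of the bottom rows v_i of these partial products.
   Conversely, if M = Id then the sequence v_i is n-periodic and its minors form
   a solution. *)
Require Import Defs.
From HB Require Import structures.
From mathcomp Require Import all_boot all_order all_algebra.
From mathcomp Require Import reals.
From mathcomp Require Import ring lra.

Set Implicit Arguments.
Unset Strict Implicit.
Unset Printing Implicit Defensive.

Import Order.TTheory GRing.Theory Num.Theory.
Local Open Scope ring_scope.

Lemma det_mx22 (K : comNzRingType) (A : 'M[K]_2) : \det A = A 0 0 * A 1 1 - A 0 1 * A 1 0.
Proof.
rewrite (expand_det_row _ 0) big_ord_recl big_ord1 /cofactor !det_mx11 !mxE /=.
rewrite expr0 expr1 mul1r mulN1r mulrN; congr (_ * A _ _ - A _ _ * A _ _); exact: val_inj.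
Qed.

Lemma det_elem_mx a : \det (elem_mx a) = 1.
Proof. by rewrite det_mx22 !mxE /= mulr0 mulr1 sub0r opprK. Qed.

Lemma elem_mx_mul0 a (A : 'M[int]_2) s :
  (elem_mx a * A) 0 s = a * A 0 s - A 1 s.
Proof.
by rewrite mxE big_ord_recl big_ord1 !mxE /= mulN1r; congr (_ - A _ _); exact: val_inj.
Qed.

Lemma elem_mx_mul1 a (A : 'M[int]_2) s : (elem_mx a * A) 1 s = A 0 s.
Proof. by rewrite mxE big_ord_recl big_ord1 !mxE /= mul1r mul0r addr0. Qed.

(** The index is a natural number so that the empty product at [m.+1] is included. *)
Definition tailM m (c : 'I_m.+1 -> int) (k : nat) : 'M[int]_2 :=
  \prod_(k <= j < m.+1) elem_mx (c (inord j)).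

Section TailProducts.
Variables (m : nat) (c : 'I_m.+1 -> int).

Lemma tailM_0 : tailM c 0 = M c.
Proof.
by rewrite /tailM big_mkord; apply: eq_bigr => i _; rewrite inord_val.
Qed.

Lemma tailM_size : tailM c m.+1 = 1.
Proof. exact: big_geq. Qed.

Lemma tailM_rec (k : 'I_m.+1) : tailM c k = elem_mx (c k) * tailM c k.+1.
Proof. by rewrite /tailM big_ltn ?inord_val. Qed.

Lemma det_tailM k : \det (tailM c k) = 1.
Proof.
rewrite /tailM; apply: (big_ind (fun A : 'M_2 => \det A = 1)) => [|A B dA dB|j _].
- exact: det1.
- by rewrite det_mulmx dA dB mulr1.
- exact: det_elem_mx.
Qed.

(** Only the wrap-around at the last vertex has content: there the full product [M c] must agree
    with the empty one. *)
Lemma tailM_ordS (k : 'I_m.+1) : M c = 1 -> tailM c (ordS k) = tailM c k.+1.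
Proof.
move=> M1 /=; have := ltn_ord k; rewrite leq_eqVlt => /predU1P[-> | lt_k].
  by rewrite modnn tailM_0 tailM_size.
by rewrite modn_small.
Qed.

End TailProducts.

Definition minors (R : realType) m (c : 'I_m.+1 -> int) : 'M[R]_m.+1 :=
  \matrix_(i, j) (tailM c i 1 0 * tailM c j 1 1 - tailM c i 1 1 * tailM c j 1 0)%:~R.

Lemma minors_solution (R : realType) m (c : 'I_m.+1 -> int) :
  M c = 1 -> is_solution c (minors R c).
Proof.
move=> M1.
have det_eq k : tailM c k 0 0 * tailM c k 1 1 - tailM c k 0 1 * tailM c k 1 0 = 1.
  by rewrite -det_mx22 det_tailM.
have next (i : 'I_m.+1) s : tailM c i 1 s = tailM c (ordS i) 0 s.
  by rewrite tailM_rec elem_mx_mul1 tailM_ordS.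
split.
- move=> i k j l _ _ _; rewrite !mxE -!intrM -intrD; congr (_%:~R); ring.
- by move=> i; rewrite mxE mulrC subrr.
(* By [next], the rows v_i and v_{i+1} are the two rows of a single tail product, of determinant
   1. *)
- by move=> i; rewrite mxE (next i) (next i) det_eq.
- by move=> i j; rewrite !mxE -intrN; congr (_%:~R); ring.
(* With t and b the top and bottom rows of the tail at i+1, v_{i-1} = c_i t - b and v_{i+1} = b, so
   the minor is c_i det(t, b) = c_i. *)
- move=> i; rewrite mxE !(next (ord_pred i)) ord_predK tailM_rec.
  rewrite !elem_mx_mul0 -tailM_ordS //; congr (_%:~R).
  by rewrite -[RHS]mulr1 -(det_eq (ordS i)); ring.
Qed.

Section Solutions.
Variables (R : realType) (m : nat) (c : 'I_m.+1 -> int) (x : 'M[R]_m.+1).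
Hypothesis sol_x : is_solution c x.

Lemma solution_plucker i k j l : x i j * x k l = x i k * x j l + x i l * x k j.
Proof.
have sk := sol_skew sol_x; have pt := sol_ptolemy sol_x.
wlog ik : i k / (i <= k)%N => [IH|].
  have [/IH//|/ltnW/IH] := leqP i k.
  by rewrite (sk k i); lra.
wlog jl : j l / (j <= l)%N => [IH|].
  have [/IH//|/ltnW/IH] := leqP j l.
  by rewrite (sk l j); lra.
wlog ij : i k j l ik jl / (i <= j)%N => [IH|].
  have [/(IH _ _ _ _ ik jl)//|/ltnW/(IH _ _ _ _ jl ik)] := leqP i j.
  by rewrite (sk j i) (sk l k) (sk j k) (sk l i); lra.
have [kj|/ltnW jk] := leqP k j; first exact: pt.
have [kl|/ltnW lk] := leqP k l.
  by have := pt i j k l ij jk kl; rewrite (sk j k); lra.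
by have := pt i j l k ij jl lk; rewrite (sk l k) (sk j k); lra.
Qed.

Lemma solution_recurrence k j :
  x (ord_pred k) j = (c k)%:~R * x k j - x (ordS k) j.
Proof.
have := solution_plucker (ord_pred k) k (ordS k) j.
have := sol_edge sol_x (ord_pred k); rewrite ord_predK => ->.
rewrite (sol_edge sol_x) (sol_diag sol_x); lra.
Qed.

Lemma iter_ordS k : (k < m.+1)%N -> val (iter k (@ordS m.+1) ord0) = k.
Proof.
elim: k => //= k IH lt_k; rewrite IH ?modn_small //; exact: ltnW.
Qed.

Lemma iter_ordS_size : iter m.+1 (@ordS m.+1) ord0 = ord0.
Proof. by apply: val_inj; rewrite /= iter_ordS // modnn. Qed.

(* The vertex [iter k ordS ord0] is k for k < n, and 0 again for k = n. *)
Lemma solution_transport k j : (k <= m.+1)%N ->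
  let v := iter k (@ordS m.+1) ord0 in
  x (ord_pred v) j = (tailM c k 0 0)%:~R * x (ord_pred ord0) j
                     + (tailM c k 0 1)%:~R * x ord0 j
  /\ x v j = (tailM c k 1 0)%:~R * x (ord_pred ord0) j
             + (tailM c k 1 1)%:~R * x ord0 j.
Proof.
(* Downward induction from [m.+1], where the vertex is 0 again and the tail is the identity. *)
move=> /subKn <-; elim: (_ - k)%N => [|d].
  by rewrite subn0 iter_ordS_size tailM_size !mxE /= !mul1r !mul0r addr0 add0r.
have [le_md|lt_dm] := leqP m.+1 d.
  (* Truncated subtraction: the index is already 0 and stays there. *)
  by rewrite subnS; move/eqP: (le_md) => ->.
have -> : (m.+1 - d = (m.+1 - d.+1).+1)%N by rewrite subnSK.
have lt_k : (m.+1 - d.+1 < m.+1)%N by rewrite ltn_subrL.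
move: (m.+1 - d.+1)%N lt_k => {lt_dm} {}k lt_k.
have -> : tailM c k = elem_mx (c (iter k (@ordS _) ord0)) * tailM c k.+1.
  by rewrite -{1}(iter_ordS lt_k) tailM_rec iter_ordS.
rewrite /= ordSK !elem_mx_mul0 !elem_mx_mul1 => -[pv sv]; split=> //.
rewrite solution_recurrence pv sv !rmorphB !rmorphM /=; ring.
Qed.

Lemma solution_entry i j :
  x i j = (tailM c i 1 0)%:~R * x (ord_pred ord0) j + (tailM c i 1 1)%:~R * x ord0 j.
Proof.
have [_] := solution_transport j (ltnW (ltn_ord i)).
by rewrite [iter _ _ _](_ : _ = i) //; apply: val_inj; rewrite iter_ordS.
Qed.

Lemma solution_last_first : x (ord_pred ord0) ord0 = 1.
Proof. by have := sol_edge sol_x (ord_pred ord0); rewrite ord_predK. Qed.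

Lemma solution_minors : x = minors R c.
Proof.
have sk := sol_skew sol_x; have e := solution_last_first.
have row_first j : x ord0 j = - (tailM c j 1 0)%:~R.
  (* Skew-symmetry turns the row into a column, whose two initial entries are known. *)
  by rewrite sk solution_entry e (sol_refl sol_x) mulr0 addr0 mulr1.
have row_last j : x (ord_pred ord0) j = (tailM c j 1 1)%:~R.
  by rewrite sk solution_entry (sk ord0) e (sol_refl sol_x); ring.
apply/matrixP => i j; rewrite mxE solution_entry row_first row_last.
by rewrite rmorphB !rmorphM /=; ring.
Qed.

Lemma solution_monodromy : M c = 1.
Proof.
have e := solution_last_first; have r0 := sol_refl sol_x.
have e' : x ord0 (ord_pred ord0) = -1 by rewrite (sol_skew sol_x) e.
(* At k = 0 the transport says that [M c] fixes the pairs from columns 0 and n-1, namely (1, 0) and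
   (0, -1). *)
have [/= + +] := solution_transport ord0 (leq0n _).
have [/= + +] := solution_transport (ord_pred ord0) (leq0n _).
rewrite tailM_0 !e !e' !r0 => m01 m11 m00 m10.
have [I00 I01] : M c 0 0 = 1 /\ M c 0 1 = 0.
  by split; apply: (@intr_inj R); rewrite /=; lra.
have [I10 I11] : M c 1 0 = 0 /\ M c 1 1 = 1.
  by split; apply: (@intr_inj R); rewrite /=; lra.
have ord2 (i : 'I_2) : i = 0 \/ i = 1.
  by case: i => [[|[|//]] lt_i2]; [left|right]; exact: val_inj.
by apply/matrixP => i j; rewrite [RHS]mxE; case: (ord2 i) (ord2 j) => -> [] ->.
Qed.

End Solutions.

Theorem theorem5p7 (R : realType) (n : nat) (c : 'I_n -> int)
    (hn : (3 <= n)%N) (hc : forall i : 'I_n, 0 < c i) :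
  (exists! x : 'M[R]_n, is_solution c x) <-> M c = 1%:M.
Proof.
case: n => [//|m] in c hn hc *; split=> [[x [sol_x _]]|M1].
  exact: solution_monodromy sol_x.
exists (minors R c); split=> [|y /solution_minors //].
exact: minors_solution.
Qed.
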